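(* Let $\mathbb{P}$ be a joint distribution of a random vector $X_V=(X_i:i\in V)$, with $V$ finite, and let $G^*$ be a DMAG with vertex set $V$ that is an IMAP of $\mathbb{P}$. Let $$G\in\arg\min_{\{H\,:\,H\text{ is an IMAP of }\mathbb{P}\}}|H| ,$$ where $H$ ranges over DMAGs with vertex set $V$ and $|H|$ is the number of edges of $H$. Then: (a) If $\mathbb{P}$ is adjacency-faithful to $G^*$, then $\mathrm{skel}(G)=\mathrm{skel}(G^* )$. (b) If $\mathbb{P}$ is restricted-faithful to $G^*$, then $G$ is Markov equivalent to $G^*$, i.e. $\mathcal{I}(G)=\mathcal{I}(G^* )$.
   Context: Graphs $G=(V,D,B)$ have a finite vertex set $V$, directed edges $D$ ($\rightarrow$) and bidirected edges $B$ ($\leftrightarrow$); $|G|:=|D|+|B|$; $\mathrm{skel}(G)$ is the undirected graph obtained by replacing every edge by an undirected edge. A path is a sequence of distinct vertices, consecutive ones being adjacent; it is directed if all its edges are directed toward later vertices. An interior vertex of a path is a collider on the path if both path edges at it have an arrowhead at it (i.e. each is either directed into it or bidirected); otherwise it is a non-collider. $G$ is a directed ancestral graph if it has no directed cycles and whenever $i\leftrightarrow j$ there is no directed path from $i$ to $j$. For $S\subseteq V\setminus\{i,j\}$, distinct vertices $i$ and $j$ are m-connected given $S$ if there is a path between them on which every non-collider is not in $S$ and every collider is in $S$ or has a descendant (via a directed path) in $S$; otherwise they are m-separated given $S$. For disjoint sets, $A$ and $B$ are m-separated given $C$, written $A\perp\!\!\!\perp_G B\mid C$, if every $a\in A$ and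 $b\in B$ are m-separated given $C$. $\mathcal{I}(G)$ is the set of all m-separation relations of $G$. $G$ is maximal if every non-adjacent pair $i,j$ is m-separated given some $S\subseteq V\setminus\{i,j\}$. A DMAG is a maximal directed ancestral graph. $\mathbb{P}$ is Markov to $G$, equivalently $G$ is an IMAP of $\mathbb{P}$, if $A\perp\!\!\!\perp_G B\mid C$ implies $X_A\perp\!\!\!\perp_{\mathbb{P}}X_B\mid X_C$ for all disjoint $A,B,C\subseteq V$. A path $\langle i,\dots,k,j\rangle$ between non-adjacent $i$ and $j$ is discriminating (for $k$) if every vertex between $i$ and $k$ on it is both a collider on the path and a parent of $j$, and there is at least one vertex between $i$ and $k$. $\mathbb{P}$ is restricted-faithful to a DMAG $G=(V,D,B)$ if it is Markov to $G$ and satisfies the following three conditions. 1. Adjacency-faithfulness: if $(i,j)\in B\cup D$, then $X_i\not\perp\!\!\!\perp_{\mathbb{P}}X_j\mid X_S$ for every $S\subseteq V\setminus\{i,j\}$. 2. Orientation-faithfulness: if $i-k-j$ is contained in $\mathrm{skel}(G)$ and $i$ is m-connected to $j$ in $G$ given $S\subseteq V\setminus\{i,j\}$, then $X_i\not\perp\!\!\!\perp_{\mathbb{P}}X_j\mid X_S$. 3. Discriminating-faithfulness: if $\langle i,\dots,k,j\rangle$ is a discriminating path in $G$ and $i$ is m-connected to $j$ in $G$ given $S\subseteq V\setminus\{i,j\}$, then $X_i\not\perp\!\!\!\perp_{\mathbb{P}}X_j\mid X_S$. $\mathbb{P}$ is adjacency-faithful to $G$ if it is Markov to $G$ and condition 1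 holds. *)

(* Defs.v *)
From HB Require Import structures.
From mathcomp Require Import all_boot all_order all_algebra.
From mathcomp Require Import all_classical all_reals all_analysis.

Set Implicit Arguments.
Unset Strict Implicit.
Unset Printing Implicit Defensive.

(* In this file [set ...] denotes a finite set ({set V}), unless it is marked
   with %classic. *)

(* A directed edge i -> j is the ordered pair (i, j); a bidirected edge
   i <-> j is the two-element set {i, j}. *)
Record mixed_graph (V : finType) := MixedGraph {
  dedges : {set V * V};
  bedges : {set {set V}};
  dedges_irr : forall i, (i, i) \notin dedges;
  bedges_card2 : forall e, e \in bedges -> #|e| = 2 }.

Section MixedGraphs.
Variable V : finType.
Implicit Types (G : mixed_graph V) (i j k : V) (p m : seq V).
Implicit Types (S A B C : {set V}).

Definition dir G : rel V := fun i j => (i, j) \in dedges G.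
Definition bid G : rel V := fun i j => [set i; j] \in bedges G.

Definition nb_edges G : nat := #|dedges G| + #|bedges G|.

Definition skel G : {set {set V}} :=
  [set [set e.1; e.2] | e in dedges G] :|: bedges G.

Definition adj G : rel V := fun i j => [set i; j] \in skel G.

(* [connect (dir G) i j] holds iff there is a directed path from i to j,
   possibly reduced to the vertex i = j. *)
Definition directed_acyclic G : Prop :=
  forall c : seq V, ucycle (dir G) c -> c = [::].

Definition ancestral G : Prop :=
  directed_acyclic G /\ forall i j, bid G i j -> ~~ connect (dir G) i j.

(* The path with vertex sequence i :: p, ending at j.  Ancestral graphs have at
   most one edge between two vertices, so the vertices determine the edges. *)
Definition is_path G i j p : bool :=
  [&& path (adj G) i p, uniq (i :: p) & last i p == j].

(* The edge between i and k has an arrowhead at k. *)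
Definition into G i k : bool := dir G i k || bid G i k.

Definition collider G i k j : bool := into G i k && into G j k.

Definition has_descendant_in G k S : Prop :=
  exists2 s, s \in S & connect (dir G) k s.

(* [infix [:: a; b; c] (i :: p)] says that a, b, c are consecutive on the path,
   so that b runs through its interior vertices. *)
Definition m_connected G i j S : Prop :=
  exists2 p, is_path G i j p &
    forall a b c, infix [:: a; b; c] (i :: p) ->
      if collider G a b c then b \in S \/ has_descendant_in G b S
      else b \notin S.

Definition m_separated G A B C : Prop :=
  forall a b, a \in A -> b \in B -> ~ m_connected G a b C.

Definition pairwise_disjoint A B C : bool :=
  [&& [disjoint A & B], [disjoint A & C] & [disjoint B & C]].

Definition msep_relations G : set ({set V} * {set V} * {set V}) :=
  [set t | pairwise_disjoint t.1.1 t.1.2 t.2 /\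
           m_separated G t.1.1 t.1.2 t.2]%classic.

Definition markov_equivalent G H : Prop :=
  msep_relations G = msep_relations H.

Definition maximal G : Prop :=
  forall i j, i != j -> ~~ adj G i j ->
    exists2 S : {set V}, S \subset ~: [set i; j] & ~ m_connected G i j S.

Definition dmag G : Prop := ancestral G /\ maximal G.

(* The path <i, m, k, j>, where m lists the vertices between i and k. *)
Definition discriminating G i m k j : Prop :=
  let p := m ++ [:: k; j] in
  [/\ is_path G i j p,
      ~~ adj G i j,
      m != [::] &
      forall b, b \in m -> dir G b j /\
        forall a c, infix [:: a; b; c] (i :: p) -> collider G a b c].

End MixedGraphs.

Section ConditionalIndependence.
Local Open Scope classical_set_scope.
Local Open Scope ring_scope.
Context (R : realType) (dO : measure_display) (Omega : measurableType dO).
Context (P : probability Omega R).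

(* f is a version of the conditional probability P(E | F), for a
   sub-sigma-algebra F. *)
Definition is_cond_prob (F : set (set Omega)) (E : set Omega)
    (f : Omega -> R) : Prop :=
  [/\ forall B : set R, measurable B -> F (f @^-1` B),
      P.-integrable setT (EFin \o f) &
      forall H, F H -> (\int[P]_(w in H) (f w)%:E = P (E `&` H))%E].

Definition cond_indep_sigma (F1 F2 F : set (set Omega)) : Prop :=
  forall E1 E2, F1 E1 -> F2 E2 ->
    exists f1 f2 f12,
      [/\ is_cond_prob F E1 f1, is_cond_prob F E2 f2,
          is_cond_prob F (E1 `&` E2) f12 &
          {ae P, forall w, f12 w = f1 w * f2 w}].

Context (V : finType) (d : V -> measure_display).
Context (T : forall i, measurableType (d i)) (X : forall i, {RV P >-> T i}).

(* The sigma-algebra generated by X_A = (X_i : i in A). *)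
Definition sigma_rv (A : {set V}) : set (set Omega) :=
  <<s \bigcup_(i in [set` A]) preimage_set_system setT (X i) measurable >>.

Definition cond_indep (A B C : {set V}) : Prop :=
  cond_indep_sigma (sigma_rv A) (sigma_rv B) (sigma_rv C).

End ConditionalIndependence.

Section Faithfulness.
Context (R : realType) (dO : measure_display) (Omega : measurableType dO).
Context (P : probability Omega R) (V : finType) (d : V -> measure_display).
Context (T : forall i, measurableType (d i)) (X : forall i, {RV P >-> T i}).
Implicit Types (G : mixed_graph V).

Definition imap G : Prop :=
  forall A B C : {set V}, pairwise_disjoint A B C ->
    m_separated G A B C -> cond_indep X A B C.

Definition adjacency_condition G : Prop :=
  forall (i j : V) (S : {set V}), dir G i j || bid G i j ->
    S \subset ~: [set i; j] -> ~ cond_indep X [set i] [set j] S.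

Definition orientation_condition G : Prop :=
  forall (i k j : V) (S : {set V}), i != j ->
    [set i; k] \in skel G -> [set k; j] \in skel G ->
    S \subset ~: [set i; j] -> m_connected G i j S ->
    ~ cond_indep X [set i] [set j] S.

Definition discriminating_condition G : Prop :=
  forall (i k j : V) (m : seq V) (S : {set V}), discriminating G i m k j ->
    S \subset ~: [set i; j] -> m_connected G i j S ->
    ~ cond_indep X [set i] [set j] S.

Definition adjacency_faithful G : Prop := imap G /\ adjacency_condition G.

Definition restricted_faithful G : Prop :=
  [/\ imap G, adjacency_condition G, orientation_condition G &
      discriminating_condition G].

Definition minimal_imap G : Prop :=
  [/\ dmag G, imap G &
      forall H : mixed_graph V, dmag H -> imap H -> nb_edges G <= nb_edges H].

End Faithfulness.

(* Main.v *)
Require Import Defs.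
From HB Require Import structures.
From mathcomp Require Import all_boot all_order all_algebra.
From mathcomp Require Import all_classical all_reals all_analysis.
From mathcomp Require Import zify.

(** A maximal graph to which the distribution is Markov cannot miss an
    adjacency of an adjacency-faithful one: two vertices that are not adjacent
    in the former are separated there, hence conditionally independent
    ([adjacency_subset]).  If the former has the fewest possible edges, it has
    no other adjacency either: an ancestral graph has at most one edge between
    two vertices, so counting edges is counting adjacencies ([nb_edges_skel],
    [minimal_imap_skel]).

    Let now [G] and [G'] have the same skeleton, [G] being Markov and [G']
    restricted-faithful.  In an unshielded triple, and more generally along a
    discriminating path, the middle vertex [k] is a collider exactly when it
    lies outside one (equivalently, every) set separating the two ends
    ([separated_collider]).  A set that separates the ends in [G] gives an
    independence, so by faithfulness it separates them in [G'] too.  Hence the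
    two graphs have the same unshielded colliders, and the same colliders at
    the end of those paths that are discriminating in both ([imap_agree]).

    It remains to see that this makes two maximal ancestral graphs Markov
    equivalent ([agree_m_connected]).  Take an m-connecting path of [G] that
    minimizes the total number of descendants of its vertices.  If a triple of
    it is shielded, the obstacle to skipping its middle vertex is a
    discriminating subpath for this vertex, on one of the two sides
    ([shielded_discriminated]).  Such a subpath is discriminating in [G'] as
    soon as its own colliders are colliders in [G'] ([agree_discriminates]), so
    a vertex whose status differs in the two graphs has another such vertex on
    its discriminating subpath.  Moving from one to the next along the path,
    two of them must point at each other, and then the two subpaths form an
    inducing path between non-adjacent vertices, against maximality
    ([no_mutual_discrimination]).  So all triples of the path have the same
    status in both graphs.  Finally a collider keeps its descendant in [S]: if
    the first edge of a shortest directed path towards [S] were not forced to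
    be the same in [G'], the collider could be replaced by its child on that
    path, which has fewer descendants ([child_discriminated]). *)

Set Implicit Arguments.
Unset Strict Implicit.
Unset Printing Implicit Defensive.

(** * Consecutive triples of a sequence *)

Section Triples.
Context (V : finType).
Implicit Types (f : V -> V -> V -> Prop) (a b c x y z : V) (s K L R : seq V).

Definition triples f s : Prop :=
  forall a b c, infix [:: a; b; c] s -> f a b c.

Definition head_triple f a b R : Prop :=
  if R is c :: _ then f a b c else True.

Definition middle_triple f L b R : Prop :=
  if L is a :: _ then head_triple f a b R else True.

Lemma sub_triples f g s :
  (forall a b c, f a b c -> g a b c) -> triples f s -> triples g s.
Proof. by move=> fg fs a b c /fs /fg. Qed.

Lemma triples_infix f s1 s : infix s1 s -> triples f s -> triples f s1.
Proof. by move=> s1s fs a b c /infix_trans -/(_ _ s1s) /fs. Qed.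

Lemma triples_cons f a b R :
  triples f (a :: b :: R) <-> head_triple f a b R /\ triples f (b :: R).
Proof.
split=> [fs|[fR fs] x y z].
  split; last by apply: triples_infix fs; exact: infix_cons.
  case: R fs => // c R fs; apply: fs.
  by rewrite infix_consl !prefix_cons prefix0s !eqxx.
rewrite infix_consl prefix_cons prefix_cons => /orP[|/fs //].
case: R {fs} fR => [_|c R /= fR]; first by rewrite !andbF.
by case/and3P=> /eqP-> /eqP-> /andP[/eqP->].
Qed.

Lemma triples1 f a : triples f [:: a].
Proof. by move=> x y z; rewrite infixs1 !eqseq_cons !andbF. Qed.

Lemma triples2 f a b : triples f [:: a; b].
Proof. by apply/triples_cons; split=> //; exact: triples1. Qed.

Lemma triples_rev f s :
  (forall a b c, f a b c -> f c b a) -> triples f s -> triples f (rev s).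
Proof.
move=> fC fs a b c; rewrite -infix_rev revK => cba; apply: fC.
by apply: fs; move: cba; rewrite /rev /=.
Qed.

Lemma triples_interior x K y :
  triples (fun _ b _ => b \in K) (x :: rcons K y).
Proof.
elim: K x => [|k K IH] x /=; first exact: triples2.
apply/triples_cons; split.
  by case: (rcons K y) => //= c R; rewrite in_cons eqxx.
by apply: sub_triples (IH k) => a b c bK; rewrite in_cons bK orbT.
Qed.

(** A path is mostly viewed from one of its vertices [b], as
    [rev L ++ b :: R]: both arms are listed from [b] outwards, so that
    reversing the path just exchanges [L] and [R]. *)
Lemma triples_zip f L b R :
  (forall a b c, f a b c -> f c b a) ->
  triples f (rev L ++ b :: R) <->
  [/\ triples f (b :: L), triples f (b :: R) & middle_triple f L b R].
Proof.
move=> fC; elim: L b R => [|a L IH] b R /=.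
  by split=> [fs|[]//]; split=> //; exact: triples1.
rewrite rev_cons cat_rcons; split.
  case/IH=> fL /triples_cons[fR fs] m; split=> //.
  by apply/triples_cons; split=> //; case: L {IH fL} m => //= y L /fC.
case=> /triples_cons[m fL] fs fR; apply/IH; split=> //.
  by apply/triples_cons.
by case: L {IH fL} m => //= y L /fC.
Qed.

Lemma arm_infix L1 x L2 b R :
  infix (rev (b :: rcons L1 x)) (rev (L1 ++ x :: L2) ++ b :: R).
Proof.
rewrite -[L1 ++ _]cat_rcons rev_cat -catA -[_ ++ b :: R]cat_rcons -rev_cons.
exact: infix_infix.
Qed.

Lemma rev_zip L b R : rev (rev L ++ b :: R) = rev R ++ b :: L.
Proof. by rewrite rev_cat revK rev_cons cat_rcons. Qed.

Lemma sorted_zip (e : rel V) L b R : symmetric e ->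
  sorted e (rev L ++ b :: R) = path e b L && path e b R.
Proof.
move=> eC; elim: L b R => [|a L IH] b R //=.
by rewrite rev_cons cat_rcons IH /= eC andbCA -!andbA.
Qed.

Lemma uniq_zip L b R : uniq (rev L ++ b :: R) = uniq (L ++ b :: R).
Proof.
rewrite !cat_uniq rev_uniq; congr [&& _, _ & _].
by rewrite (eq_has (mem_rev L)).
Qed.

Lemma ohead_zip L b R : ohead (rev L ++ b :: R) = Some (last b L).
Proof. by case/lastP: L => // L z; rewrite rev_rcons last_rcons. Qed.

End Triples.

(** * Ancestral graphs *)

Section MixedGraphs.
Context (V : finType).
Implicit Types (G : mixed_graph V) (a b c i j k t u v x y z : V).
Implicit Types (s p m L R : seq V) (S : {set V}).

Lemma bidC G : symmetric (bid G).
Proof. by move=> a b; rewrite /bid finset.setUC. Qed.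

Lemma adjC G : symmetric (adj G).
Proof. by move=> a b; rewrite /adj finset.setUC. Qed.

Lemma colliderC G a b c : collider G a b c = collider G c b a.
Proof. exact: andbC. Qed.

Lemma adjE G a b : adj G a b = [|| dir G a b, dir G b a | bid G a b].
Proof.
rewrite /adj /skel finset.in_setU; apply/orP/or3P.
  case=> [|e]; last exact: Or33.
  case/imsetP=> [[x y]] /= xy ab.
  have [xab yab] : x \in [set a; b]%SET /\ y \in [set a; b]%SET.
    by rewrite ab !inE !eqxx orbT.
  have [axy bxy] : a \in [set x; y]%SET /\ b \in [set x; y]%SET.
    by rewrite -ab !inE !eqxx orbT.
  move: xab yab axy bxy; rewrite !inE.
  have nxy : x != y by apply: contraL xy => /eqP->; exact: dedges_irr.
  case/orP=> /eqP ?; case/orP=> /eqP ?; subst; rewrite ?eqxx // in nxy *.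
  - by move=> *; exact: Or31.
  - by move=> *; exact: Or32.
case=> [ab|ba|ab]; [left|left|by right]; apply/imsetP.
  by exists (a, b).
by exists (b, a) => //=; rewrite finset.setUC.
Qed.

Lemma adjE_into G a b : adj G a b = into G a b || into G b a.
Proof.
rewrite adjE /into (bidC G b a).
by case: (dir G a b); case: (dir G b a); case: (bid G a b).
Qed.

Lemma into_adj G a b : into G a b -> adj G a b.
Proof. by rewrite adjE_into => ->. Qed.

Lemma dir_adj G a b : dir G a b -> adj G a b.
Proof. by rewrite adjE => ->. Qed.

Lemma adj_neq G a b : adj G a b -> a != b.
Proof.
move=> ab; apply/eqP => e; subst; move: ab; rewrite adjE !orbA orbb.
case/orP=> [|/bedges_card2]; first by rewrite /dir (negPf (dedges_irr G b)).
by rewrite finset.setUid cards1.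
Qed.

Lemma dir_into G a b : dir G a b -> into G a b.
Proof. by rewrite /into => ->. Qed.

Lemma tail_dir G a b : adj G a b -> ~~ into G b a -> dir G a b.
Proof.
rewrite adjE /into (bidC G b a).
by case: (dir G a b); case: (dir G b a); case: (bid G a b).
Qed.

Section Ancestral.
Context (G : mixed_graph V) (ancG : ancestral G).

Lemma dir_acyclic a b : connect (dir G) a b -> ~~ dir G b a.
Proof.
case/connectP=> p ap ->; case/shortenP: ap => q aq Uq _.
apply/negP => la; have [acy _] := ancG.
suff /acy : ucycle (dir G) (a :: q) by [].
by rewrite /ucycle /cycle rcons_path aq la.
Qed.

Lemma dir_intoN a b : dir G a b -> ~~ into G b a.
Proof.
move=> ab; rewrite /into negb_or dir_acyclic ?connect1 //=.
apply: contraL (connect1 ab) => ba.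
by have [_] := ancG; apply; rewrite bidC.
Qed.

Lemma into_connectN a b : into G a b -> ~~ connect (dir G) b a.
Proof.
case/orP=> ab; first by apply: contraL ab; exact: dir_acyclic.
by have [_] := ancG; apply; rewrite bidC.
Qed.

(** If [y *-> a -> t] and [y], [t] are adjacent, then their edge points at
    [t]: otherwise [t] would be an ancestor of [y], and so would [a]. *)
Lemma into_dir_into y a t :
  into G y a -> dir G a t -> adj G y t -> into G y t.
Proof.
move=> ya at_; rewrite adjE_into => /orP[//|ty].
apply/negPn/negP => nyt.
have dty : dir G t y by apply: tail_dir; rewrite ?into_adj.
have := into_connectN ya.
by rewrite (connect_trans (connect1 at_) (connect1 dty)).
Qed.

(** Under the same assumptions [y <-> t] forces [y <-> a]: replacing the edge
    [y - a] by [y - t] never creates an arrowhead at [y]. *)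
Lemma into_dir_mark y a t :
  into G y a -> dir G a t -> into G t y -> into G a y.
Proof.
move=> /orP[ya|ya] at_ ty; last by rewrite /into bidC ya orbT.
have := into_connectN ty.
by rewrite (connect_trans (connect1 ya) (connect1 at_)).
Qed.

Lemma into_neq_dir y a t : into G y a -> dir G a t -> y != t.
Proof.
move=> ya at_; apply: contraTneq ya => ->.
exact: dir_intoN.
Qed.

End Ancestral.

(** * Lightest m-connecting paths *)

Definition unblocked G S a b c : Prop :=
  if collider G a b c then b \in S \/ has_descendant_in G b S
  else b \notin S.

Definition connecting G S i j s : Prop :=
  [/\ sorted (adj G) s, uniq s, triples (unblocked G S) s,
      ohead s = Some i & ohead (rev s) = Some j].

(** The number of descendants strictly decreases along a directed edge, and
    every vertex counts as its own descendant.  So a path gets lighter when a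
    vertex is skipped, and also when it is replaced by one of its children. *)
Definition weight G s : nat :=
  \sum_(v <- s) #|[set u | connect (dir G) v u]|.

Definition lightest G S i j s : Prop :=
  connecting G S i j s /\
  forall s', connecting G S i j s' -> weight G s <= weight G s'.

Definition colliders G s : Prop :=
  triples (fun a b c => collider G a b c) s.

(** A subpath [x, rev L1, b, t] that discriminates for [b], with [L1] listed
    from [b] outwards; an empty [L1] is the unshielded triple [x, b, t]. *)
Definition discriminates G L1 x b t : Prop :=
  [/\ x != t, ~~ adj G x t, all (fun z => dir G z t) L1 &
      colliders G (b :: rcons L1 x)].

Lemma unblockedC G S a b c : unblocked G S a b c -> unblocked G S c b a.
Proof. by rewrite /unblocked colliderC. Qed.

Lemma m_connectedP G i j S :
  m_connected G i j S <-> exists s, connecting G S i j s.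
Proof.
split=> [[p /and3P[ap Up /eqP lp] okp]|[[|x p] [//= ap Up okp [<-]]]].
  exists (i :: p); split=> //.
  by rewrite lastI rev_rcons /= lp.
rewrite lastI rev_rcons => -[lp]; exists p => //.
by apply/and3P; split=> //; apply/eqP.
Qed.

Lemma ex_minimizer (A : Type) (Q : A -> Prop) (f : A -> nat) :
  (exists w : A, Q w) -> exists w : A, Q w /\ forall w', Q w' -> f w <= f w'.
Proof.
case=> w Qw; have ex : exists n, `[< exists2 w, Q w & f w = n >].
  by exists (f w); apply/asboolP; exists w.
case: (ex_minnP ex) => n /asboolP[w' Qw' fw'] nmin.
by exists w'; split=> // z Qz; rewrite fw' nmin //; apply/asboolP; exists z.
Qed.

Lemma connecting_zip G S i j L b R :
  connecting G S i j (rev L ++ b :: R) <->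
  [/\ path (adj G) b L && path (adj G) b R, uniq (L ++ b :: R),
      triples (unblocked G S) (b :: L), triples (unblocked G S) (b :: R) &
      middle_triple (unblocked G S) L b R] /\ last b L = i /\ last b R = j.
Proof.
rewrite /connecting (sorted_zip _ _ _ (@adjC G)) uniq_zip rev_zip !ohead_zip.
have okC := @unblockedC G S.
split=> [[-> -> /(triples_zip _ _ _ okC)[tL tR m] [->] [->]]|].
  by split; split.
by case=> -[-> -> tL tR m] [-> ->]; split=> //; apply/triples_zip.
Qed.

Lemma connecting_rev G S i j s :
  connecting G S i j s -> connecting G S j i (rev s).
Proof.
case=> ss Us ts si sj; split; rewrite ?rev_uniq ?revK //.
  by rewrite rev_sorted; under eq_sorted => ? ? do rewrite adjC.
by apply: triples_rev ts => a b c; exact: unblockedC.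
Qed.

Lemma weight_cat G s1 s2 : weight G (s1 ++ s2) = weight G s1 + weight G s2.
Proof. exact: big_cat. Qed.

Lemma weight_rev G s : weight G (rev s) = weight G s.
Proof. by apply: perm_big; rewrite perm_rev. Qed.

Lemma weight_cons G a s :
  weight G (a :: s) = #|[set u | connect (dir G) a u]| + weight G s.
Proof. exact: big_cons. Qed.

Lemma lightest_rev G S i j s :
  lightest G S i j s -> lightest G S j i (rev s).
Proof.
case=> cs smin; split; first exact: connecting_rev.
move=> s' /connecting_rev /smin; by rewrite !weight_rev.
Qed.

Lemma card_desc_gt0 G a : 0 < #|[set u | connect (dir G) a u]|.
Proof. by apply/card_gt0P; exists a; rewrite inE connect0. Qed.

Lemma card_desc_lt G a b : ancestral G -> dir G a b ->
  #|[set u | connect (dir G) b u]| < #|[set u | connect (dir G) a u]|.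
Proof.
move=> ancG ab; apply/proper_card/properP; split.
  apply/fintype.subsetP => u; rewrite !inE; exact: connect_trans (connect1 ab).
exists a; rewrite !inE ?connect0 //.
by apply: contraL ab; exact: dir_acyclic.
Qed.

(** Joining [x] directly to a later vertex [t] of the path skips [b], so the
    result is lighter and must be blocked.  The hypotheses rule this out at
    [x]; at [t] the arrowhead of the new edge was there already, or makes it
    at worst a collider with a descendant in [S]. *)
Lemma no_shortcut G S i j L1 x L2 b R1 t R2 : ancestral G ->
  lightest G S i j (rev (L1 ++ x :: L2) ++ b :: R1 ++ t :: R2) ->
  into G x t -> head_triple (unblocked G S) t x L2 ->
  into G (last b R1) t \/ has_descendant_in G t S -> False.
Proof.
move=> ancG [cs smin] xt okx okt.
suff cs' : connecting G S i j (rev (x :: L2) ++ t :: R2).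
  have := smin _ cs'; rewrite !(weight_cat, weight_rev, weight_cons).
  by have := card_desc_gt0 G b; lia.
case/connecting_zip: cs => -[/andP[aL aR] U tL tR _] [li lj].
have tL' : triples (unblocked G S) (x :: L2).
  apply: triples_infix tL; rewrite -cat_cons.
  exact: suffixW (suffix_suffix _ _).
have tR' : triples (unblocked G S) (t :: R2).
  apply: triples_infix tR; rewrite -cat_cons.
  exact: suffixW (suffix_suffix _ _).
have tR'' : head_triple (unblocked G S) (last b R1) t R2.
  case: R2 {smin U aR lj} tR {tR'} => //= c R2 tR; apply: tR.
  rewrite -cat_cons (lastI b R1) cat_rcons.
  exact: (infix_infix _ [:: _; _; _]).
apply/connecting_zip; split; last first.
  by rewrite last_cat /= in li; rewrite last_cat /= in lj.
split=> //.
- move: aL aR; rewrite !cat_path /= => /and3P[_ _ ->] /and3P[_ _ ->].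
  by rewrite adjC into_adj.
- apply: subseq_uniq U; apply: cat_subseq; first exact: suffix_subseq.
  by rewrite -cat_cons; exact: suffix_subseq.
- by apply/triples_cons.
case: R2 tR'' {smin U aR lj tR tR'} => //= c R2.
rewrite /unblocked /collider xt /=; case: okt => [lt|ht]; first by rewrite lt.
by case: (into G c t); [right|rewrite andbF].
Qed.

(** One moves away from [b] in search of a vertex that can be joined to [t].
    A vertex adjacent to [t] is unsuitable only if it is a collider in [S] and
    a parent of [t].  Past such vertices, the search ends with a suitable one,
    or with one not adjacent to [t], which completes a discriminating
    subpath. *)
Lemma climb G S b L t : ancestral G -> L != [::] ->
  triples (unblocked G S) (b :: L) -> path (adj G) b L ->
  (if L is a :: _ then
     a != t /\ (adj G a t -> into G a t /\
       (into G t a -> into G b a \/ has_descendant_in G a S))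
   else True) ->
  exists L1 x L2, L = L1 ++ x :: L2 /\
    ((into G x t /\ head_triple (unblocked G S) t x L2) \/
     discriminates G L1 x b t).
Proof.
move=> ancG; elim: L b => // a L IH b _ tbL /= /andP[ba aL] [nat_ at_].
have [aadjt|naadjt] := boolP (adj G a t); last first.
  exists [::], a, L; split=> //; right; split=> //.
  exact: triples2.
have {at_}[iat ta] := at_ aadjt.
case: L IH tbL aL => [|y L] IH tbL aL.
  by exists [::], a, [::]; split=> //; left.
have [okt|nokt] := pselect (unblocked G S t a y).
  by exists [::], a, (y :: L); split=> //; left.
have [/= okb taL] := (triples_cons _ _ _ _).1 tbL.
(* [a] was unblocked and no new arrowhead at it can block it, so it has lost
   one: it was a collider, and as a non-collider it is blocked by [S]. *)
have [bay dat] : collider G b a y /\ dir G a t.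
  move: okb nokt; rewrite /unblocked /collider.
  have [ita|nita] := boolP (into G t a) => /=; last first.
    case: ifP => // _ _ _; split=> //.
    by apply: tail_dir.
  case: (boolP (into G y a)) => /= [_|_]; last by rewrite andbF.
  by case: (ta ita) => [->//|hd] _ []; right.
have ya : into G y a by case/andP: bay.
have [||L1 [x [L2 [eL H]]]] := IH a _ taL aL; first by [].
  split; first exact: into_neq_dir ya dat.
  move=> yt; split; first exact: into_dir_into dat yt.
  by move=> ty; left; exact: into_dir_mark dat ty.
exists (a :: L1), x, L2; split; first by rewrite eL.
case: H => [|[xt nxt dL1 cL1]]; first by left.
right; split=> //=; first by rewrite dat.
apply/triples_cons; split=> //.
by case: L1 eL {dL1 cL1} => [|z L1] [<-].
Qed.

Definition discriminated G L b t : Prop :=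
  exists L1 x L2, L = L1 ++ x :: L2 /\ discriminates G L1 x b t.

Lemma unblocked_collider G S a b c :
  collider G a b c -> unblocked G S a b c -> has_descendant_in G b S.
Proof. by rewrite /unblocked => -> [bS|//]; exists b. Qed.

Lemma has_descendant_dir G S a b :
  dir G a b -> has_descendant_in G b S -> has_descendant_in G a S.
Proof.
by move=> ab [s sS bs]; exists s => //; exact: connect_trans (connect1 ab) bs.
Qed.

(** The two conditions on marks say that skipping [b] creates a new arrowhead
    at [a] or [c] only if [b] is a collider; then the vertex with the new
    arrowhead is a parent of [b], so it has a descendant in [S] and may become
    a collider. *)
Lemma shielded_left G S i j a L b c R : ancestral G ->
  lightest G S i j (rev (a :: L) ++ b :: c :: R) -> into G a c ->
  (into G c a -> into G b a \/ collider G a b c) ->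
  (into G b c \/ collider G a b c) -> discriminated G (a :: L) b c.
Proof.
move=> ancG smin iac ca bc; have [cs _] := smin.
case/connecting_zip: cs => -[/andP[aL aR] U tL _ /= okb] _.
have anc z : adj G z b -> collider G a b c -> ~~ into G b z ->
    has_descendant_in G z S.
  move=> zb col nbz; apply: has_descendant_dir (tail_dir zb nbz) _.
  exact: unblocked_collider col okb.
have [//||L1 [x [L2 [eL]]]] := climb (t := c) ancG _ tL aL.
  split.
    apply: contraTneq U => ->.
    by rewrite cat_cons cons_uniq mem_cat !inE eqxx !orbT.
  move=> _; split=> // /ca [->|col]; first by left.
  have [_|nba] := boolP (into G b a); first by left.
  by right; apply: anc nba => //; rewrite adjC; case/andP: aL.
case=> [[xc okx]|dis]; last by exists L1, x, L2.
rewrite eL in smin; case: (no_shortcut (R1 := [::]) ancG smin xc okx) => /=.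
have [_|nbc] := boolP (into G b c); first by left.
right; apply: (anc _ _ _ nbc); first by rewrite adjC; case/andP: aR.
by case: bc => [|//]; rewrite (negPf nbc).
Qed.

(** On a lightest path the only obstacle to the shortcut [a - c] of a shielded
    triple is a discriminating subpath, on one of the two sides. *)
Lemma shielded_discriminated G S i j a L b c R : ancestral G ->
  lightest G S i j (rev (a :: L) ++ b :: c :: R) -> adj G a c ->
  discriminated G (a :: L) b c \/ discriminated G (c :: R) b a.
Proof.
move=> ancG smin ac; have [cs _] := smin.
case/connecting_zip: cs => -[/= /andP[/andP[ba _] /andP[bc _]] _ _ _ _] _.
have smin' := lightest_rev smin; rewrite rev_zip in smin'.
have left_ := shielded_left ancG smin; have right_ := shielded_left ancG smin'.
rewrite (colliderC G c b a) in right_.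
have [col|ncol] := boolP (collider G a b c).
  move: ac; rewrite adjE_into => /orP[ac|ca].
    by left; apply: left_ => //; right.
  by right; apply: right_ => //; right.
wlog : i j a L c R ac smin smin' ba bc left_ right_ ncol / ~~ into G c b.
  move=> W; move: (ncol); rewrite negb_and => /orP[nab|ncb].
    apply/or_comm; apply: (W j i c R a L) => //; rewrite ?(colliderC G c) //.
  by rewrite adjC.
  by apply: (W i j a L c R).
move=> ncb; have dbc : dir G b c by apply: tail_dir.
have [iab|nab] := boolP (into G a b).
  left; apply: left_.
  - exact: into_dir_into iab dbc ac.
  - by move=> ca; left; exact: into_dir_mark iab dbc ca.
  - by left; exact: dir_into.
have dba : dir G b a by apply: tail_dir.
move: ac; rewrite adjE_into => /orP[ac|ca].
  by left; apply: left_ => // *; left; exact: dir_into.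
by right; apply: right_ => // *; left; exact: dir_into.
Qed.

(** If neither arm discriminates, both can be joined to the child [t] of [b],
    and the path through [t] instead of [b] is lighter. *)
Lemma child_discriminated G S i j a L b c R t : ancestral G ->
  lightest G S i j (rev (a :: L) ++ b :: c :: R) -> collider G a b c ->
  dir G b t -> has_descendant_in G t S ->
  discriminated G (a :: L) b t \/ discriminated G (c :: R) b t.
Proof.
move=> ancG smin /andP[ab cb] bt ht; have [cs wmin] := smin.
case/connecting_zip: cs => -[/andP[aL aR] U tL tR _] [li lj].
have joins z : into G z b -> z != t /\ (adj G z t -> into G z t /\
    (into G t z -> into G b z \/ has_descendant_in G z S)).
  move=> zb; split; first exact: into_neq_dir zb bt.
  move=> zt; split; first exact: into_dir_into zb bt zt.
  by move=> tz; left; exact: into_dir_mark zb bt tz.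
have [//||L1 [x [L2 [eL [[xt okx]|dis]]]]] := climb (t := t) ancG _ tL aL.
- exact: joins.
- have [//||R1 [y [R2 [eR [[yt oky]|dis]]]]] := climb (t := t) ancG _ tR aR.
  + exact: joins.
  + (* If [t] is on the path already, joining it to [x] or [y] is a shortcut. *)
    have tNR : t \notin c :: R.
      apply/negP => tR'; move: smin; rewrite eL.
      case/splitPr: tR' => R3 R4 smin.
      by apply: (no_shortcut ancG smin xt okx); right.
    have tNL : t \notin a :: L.
      apply/negP => tL'; move: (lightest_rev smin); rewrite rev_zip eR.
      case/splitPr: tL' => L3 L4 smin'.
      by apply: (no_shortcut ancG smin' yt oky); right.
    rewrite eL eR in smin wmin aL aR U tL tR li lj tNR tNL.
    suff cs' : connecting G S i j (rev (x :: L2) ++ t :: y :: R2).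
      have := wmin _ cs'; rewrite eL eR !(weight_cat, weight_rev, weight_cons).
      by move: (card_desc_lt ancG bt); clear; lia.
    apply/connecting_zip; split; last first.
      by rewrite !last_cat /= in li lj.
    split.
    * move: aL aR; rewrite !cat_path /= => /and3P[_ _ ->] /and3P[_ _ ->].
      by rewrite !(adjC _ t) !into_adj.
    * have : uniq (x :: L2 ++ y :: R2).
        apply: subseq_uniq U; rewrite -cat_cons; apply: cat_subseq.
          exact: suffix_subseq.
        by rewrite -cat_cons; exact: suffix_subseq.
      move: tNR tNL; rewrite !mem_cat => /norP[_ tR2] /norP[_ tL2].
      move=> U'; rewrite -[t :: _]/([:: t] ++ _) uniq_catCA.
      by apply/andP; split=> //; rewrite mem_cat; apply/norP.
    * apply/triples_cons; split=> //; apply: triples_infix tL.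
      by rewrite -cat_cons; exact: suffixW (suffix_suffix _ _).
    * apply/triples_cons; split=> //; apply: triples_infix tR.
      by rewrite -cat_cons; exact: suffixW (suffix_suffix _ _).
    * by rewrite /= /unblocked /collider xt yt; right.
  + by right; exists R1, y, R2.
- by left; exists L1, x, L2.
Qed.

(** * Graphs with the same unshielded and discriminated colliders *)

(** The classical graphical criterion for Markov equivalence of maximal
    ancestral graphs. *)
Definition agree G H : Prop :=
  [/\ adj G =2 adj H,
      forall a b c, a != c -> adj G a b -> adj G b c -> ~~ adj G a c ->
        collider G a b c = collider H a b c &
      forall i m k j, discriminating G i m k j -> discriminating H i m k j ->
        collider G (last i m) k j = collider H (last i m) k j].

Lemma discriminates_notin G L1 x b t :
  adj G b t -> discriminates G L1 x b t -> t \notin b :: rcons L1 x.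
Proof.
move=> bt [xt _ /allP dL1 _]; rewrite in_cons mem_rcons in_cons !negb_or.
rewrite eq_sym (adj_neq bt) eq_sym xt /=.
by apply/negP => /dL1 /dir_adj /adj_neq; rewrite eqxx.
Qed.

Lemma discriminates_path G L1 x b t : L1 != [::] ->
  path (adj G) b (rcons L1 x) -> uniq (b :: rcons L1 x) -> adj G b t ->
  discriminates G L1 x b t -> discriminating G x (rev L1) b t.
Proof.
move=> nL1 aL U bt dis; have tN := discriminates_notin bt dis.
have [xt nxt /allP dL1 cL1] := dis.
have eqp : x :: rev L1 ++ [:: b; t] = rev (rcons L1 x) ++ b :: [:: t].
  by rewrite rev_rcons.
split=> //.
- apply/and3P; split; last by rewrite last_cat.
    rewrite -[path _ _ _]/(sorted _ (x :: rev L1 ++ [:: b; t])) eqp.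
    by rewrite (sorted_zip _ _ _ (@adjC G)) aL /= bt.
  rewrite eqp uniq_zip -cat_rcons cats1 rcons_uniq.
  by rewrite mem_rcons tN rcons_uniq.
- by rewrite -size_eq0 size_rev size_eq0.
move=> z; rewrite mem_rev => zL1; split; first exact: dL1.
suff : triples (fun u v w => v \in L1 -> collider G u v w)
    (x :: rev L1 ++ [:: b; t]) by move=> H a c /H; apply.
rewrite eqp; apply/triples_zip; first by move=> u v w; rewrite colliderC.
split; last first.
- have bN : b \notin L1.
    by move: U; rewrite cons_uniq mem_rcons in_cons => /andP[/norP[]].
  by case: (rcons L1 x) => //= y _ bL1; rewrite bL1 in bN.
- exact: triples2.
- by apply: sub_triples cL1.
Qed.

Section Agreement.
Context (G H : mixed_graph V) (ancG : ancestral G) (GH : agree G H).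

Lemma agree_status L1 x b t :
  path (adj G) b (rcons L1 x) -> uniq (b :: rcons L1 x) -> adj G b t ->
  discriminates G L1 x b t -> discriminates H L1 x b t ->
  collider G (head x L1) b t = collider H (head x L1) b t.
Proof.
have [adjGH unsh disc] := GH; move=> aL U bt disG disH.
have [xt nxt _ _] := disG.
case: L1 => [|a L1] in aL U disG disH *.
  by apply: unsh => //; rewrite adjC; case/andP: aL.
have -> : head x (a :: L1) = last x (rev (a :: L1)).
  by rewrite rev_cons last_rcons.
apply: disc; apply: discriminates_path => //.
  by move: aL; rewrite (eq_path adjGH).
by rewrite -adjGH.
Qed.

Lemma agree_parent L1 x b t :
  path (adj G) b (rcons L1 x) -> uniq (b :: rcons L1 x) -> dir G b t ->
  discriminates G L1 x b t -> discriminates H L1 x b t ->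
  into H (head x L1) b -> dir H b t.
Proof.
have [adjGH _ _] := GH; move=> aL U bt disG disH hb.
apply: tail_dir; first by rewrite -adjGH dir_adj.
have := agree_status aL U (dir_adj bt) disG disH.
rewrite /collider hb (negPf (dir_intoN ancG bt)) andbF.
by case: (into H t b).
Qed.

(** The vertices of a discriminating path are shown to be parents of [t] in [H]
    one after the other, starting from its far end: each of them is
    discriminated by the part of the path that lies before it. *)
Lemma agree_discriminates L1 x b t :
  path (adj G) b (rcons L1 x) -> uniq (b :: rcons L1 x) ->
  discriminates G L1 x b t -> colliders H (b :: rcons L1 x) ->
  discriminates H L1 x b t.
Proof.
have [adjGH _ _] := GH.
elim: L1 b => [|a L1 IH] b /= aL U [xt nxt dL1 cL1] cH.
  by split; rewrite -?adjGH.
have [ba aL'] := andP aL; have [bN U'] := andP U; have [dat dL1'] := andP dL1.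
have [_ cL1'] := (triples_cons _ _ _ _).1 cL1.
have [hH cH'] := (triples_cons _ _ _ _).1 cH.
have disG : discriminates G L1 x a t by split.
have disH := IH a aL' U' disG cH'.
have [_ nxtH dH _] := disH; split=> //=; rewrite dH andbT.
apply: agree_parent disG disH _ => //.
by case: (L1) hH => [|h L1''] /= /andP[].
Qed.

(** A triple of a shortest directed path to [S] is unshielded, since [b -> c]
    would be a shortcut; so it is a non-collider in both graphs and the
    orientation of its first edge is passed on to the second. *)
Lemma agree_directed_path S b t q :
  path (dir G) b (t :: q) -> last t q \in S ->
  (forall q', path (dir G) b q' -> last b q' \in S -> size q < size q') ->
  dir H b t -> path (dir H) b (t :: q).
Proof.
have [adjGH unsh _] := GH.
elim: q b t => [|c q IH] b t /=; first by move=> _ _ _ ->.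
case/and3P=> bt tc pq lq qmin Hbt; rewrite Hbt /=.
have nbc : ~~ adj G b c.
  apply/negP => bc; have ibc := into_dir_into ancG (dir_into bt) tc bc.
  have dbc : dir G b c.
    apply: tail_dir => //; apply/negP => /(into_connectN ancG).
    by rewrite (connect_trans (connect1 bt) (connect1 tc)).
  by have := qmin (c :: q); rewrite /= dbc pq lq ltnn => /(_ isT isT).
have Htc : dir H t c.
  apply: tail_dir; first by rewrite -adjGH dir_adj.
  have := unsh _ _ _ (into_neq_dir ancG (dir_into bt) tc) (dir_adj bt)
    (dir_adj tc) nbc.
  rewrite /collider (negPf (dir_intoN ancG tc)) andbF.
  by rewrite (dir_into Hbt); case: (into H c t).
apply: IH => //=; first by rewrite tc.
by move=> q' pq' lq'; apply: (qmin (t :: q')) => //=; rewrite bt.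
Qed.

End Agreement.

(** * Agreement along a lightest path *)

(** No set blocks such a path: an interior vertex outside [S] gives a
    connection of length two, and if there is none the path itself
    connects. *)
Lemma inducing_path_m_connected G S x K y :
  is_path G x y (rcons K y) -> colliders G (x :: rcons K y) ->
  (forall z, z \in K -> [/\ adj G x z, adj G z y & ~~ collider G x z y]) ->
  m_connected G x y S.
Proof.
move=> pK cK dK.
have [/allP KS|/allPn[z zK zS]] := boolP (all (fun z => z \in S) K).
  exists (rcons K y) => // a b c abc; rewrite (cK _ _ _ abc); left; apply: KS.
  exact: triples_interior abc.
have [xz zy ncz] := dK z zK.
exists [:: z; y].
  apply/and3P; split=> //=; first by rewrite xz zy.
  rewrite !inE !negb_or (adj_neq xz) (adj_neq zy) /= andbT.
  case/and3P: pK => _ /=; rewrite mem_rcons inE negb_or => /andP[/andP[]] //.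
suff : triples (unblocked G S) [:: x; z; y] by [].
apply/triples_cons; split; last exact: triples2.
by rewrite /= /unblocked (negPf ncz).
Qed.

Lemma zip_inj L b R L' R' : uniq (rev L ++ b :: R) ->
  rev L ++ b :: R = rev L' ++ b :: R' -> L = L' /\ R = R'.
Proof.
move=> U e; have U' := U; rewrite e in U'.
have idx M N : uniq (rev M ++ b :: N) ->
    index b (rev M ++ b :: N) = size (rev M).
  rewrite cat_uniq => /and3P[_ /hasPn /(_ b)].
  rewrite inE eqxx => /(_ isT) bM _.
  by rewrite index_cat (negPf bM) /= eqxx addn0.
have sz : size (rev L) = size (rev L') by rewrite -(idx L R) // e idx.
move/eqP: e; rewrite eqseq_cat // eqseq_cons eqxx.
by case/andP=> /eqP /(can_inj revK) -> /eqP.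
Qed.

(** A path meets [v] only once, so [v] alone determines the triple of which it
    is the middle; for endpoints there is none, and no disagreement. *)
Definition disagree G H s v : bool :=
  [exists a, exists c, infix [:: a; v; c] s &&
     (collider G a v c != collider H a v c)].

Lemma disagree_rev G H s v : disagree G H (rev s) v = disagree G H s v.
Proof.
apply/existsP/existsP => -[a /existsP[c /andP[acs ne]]];
  exists c; apply/existsP; exists a; rewrite !(colliderC _ c) ne andbT.
  by rewrite -infix_rev; move: acs; rewrite /rev.
by rewrite -infix_rev revK; move: acs.
Qed.

Lemma disagreeP G H s L b R : uniq s -> s = rev L ++ b :: R ->
  disagree G H s b -> exists a L' c R', [/\ L = a :: L', R = c :: R' &
    collider G a b c != collider H a b c].
Proof.
move=> U es /existsP[a /existsP[c /andP[/infixP[s1 [s2 e]] ne]]].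
have e' : rev L ++ b :: R = rev (a :: rev s1) ++ b :: c :: s2.
  by rewrite -es e rev_cons revK cat_rcons.
have [-> ->] : L = a :: rev s1 /\ R = c :: s2.
  by apply: zip_inj e'; rewrite -es.
by exists a, (rev s1), c, s2.
Qed.

Lemma agree_triples G H s :
  (forall v, v \in s -> ~~ disagree G H s v) ->
  triples (fun a b c => collider G a b c = collider H a b c) s.
Proof.
move=> nd a b c abc; apply/eqP/negPn/negP => ne.
have bs : b \in s by apply: (mem_infix abc); rewrite !inE eqxx orbT.
have /negP := nd b bs; apply; apply/existsP; exists a; apply/existsP.
by exists c; rewrite abc.
Qed.

Section LightestPath.
Context (G H : mixed_graph V) (S : {set V}).
Context (ancG : ancestral G) (maxG : maximal G) (GH : agree G H).

(** If the interior of a discriminating subpath agrees, the subpath is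
    discriminating in [H] too, and then so does the discriminated vertex. *)
Lemma disagree_discriminates i j s L1 x L2 b c R :
  connecting G S i j s -> s = rev (L1 ++ x :: L2) ++ b :: c :: R ->
  discriminates G L1 x b c -> disagree G H s b ->
  has (disagree G H s) L1.
Proof.
move=> cs es dis /(disagreeP _ es) [].
  by case: cs.
move=> a [L' [c' [R' [eL [<- _] /eqP ne]]]].
apply/negPn/negP => /hasPn nd; apply: ne.
rewrite es in cs; case/connecting_zip: cs => -[/andP[aL /andP[bc _]] U _ _ _] _.
have aL1 : path (adj G) b (rcons L1 x).
  by move: aL; rewrite -cat_rcons cat_path => /andP[].
have U1 : uniq (b :: rcons L1 x).
  have : subseq (rcons L1 x ++ [:: b]) ((L1 ++ x :: L2) ++ b :: c :: R).
    rewrite -[L1 ++ x :: L2]cat_rcons; apply: cat_subseq.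
      exact: prefix_subseq.
    by rewrite sub1seq in_cons eqxx.
  by move/subseq_uniq => /(_ U); rewrite cats1 rcons_uniq.
have -> : a = head x L1 by case: (L1) eL => [|? ?] [].
apply: (agree_status GH) => //.
apply: (agree_discriminates ancG GH) => // u v w uvw.
have wvu : infix [:: w; v; u] s.
  rewrite es; apply: infix_trans (arm_infix _ _ _ _ _).
  by rewrite -infix_rev in uvw.
have vL1 : v \in L1 by exact: triples_interior uvw.
have [_ _ _ cL1] := dis; have cuvw := cL1 _ _ _ uvw.
apply: contraNT (nd v vL1) => ncH.
apply/existsP; exists w; apply/existsP; exists u.
by rewrite wvu !(colliderC _ w) cuvw (negPf ncH).
Qed.


(** Two vertices [u] and [b] of a path cannot discriminate each other
    from both sides: the two discriminating subpaths would have the same ends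
    [x] and [c], and together they would make an inducing path between these
    two vertices, although they are not adjacent. *)
Lemma no_mutual_discrimination i j s L M u N x b c R R1 R2 y :
  connecting G S i j s -> s = rev L ++ b :: c :: R ->
  (exists L2, L = (M ++ u :: N) ++ x :: L2) ->
  discriminates G (M ++ u :: N) x b c ->
  c :: R = R1 ++ y :: R2 ->
  discriminates G (rev M ++ b :: R1) y u (head x N) -> False.
Proof.
move=> cs es [L2 eL] [xc nxc /allP dL1 cL1] eR [yh nyh /allP dR1 cR1].
have duc : dir G u c by apply: dL1; rewrite mem_cat mem_head orbT.
have hu : into G (head x N) u.
  have cl : infix [:: last b M; u; head x N] (b :: rcons (M ++ u :: N) x).
    rewrite rcons_cat rcons_cons -cat_cons (lastI b M) cat_rcons.
    by case: (N) => [|a N']; exact: (infix_infix _ [:: _; _; _]).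
  by case/andP: (cL1 _ _ _ cl).
(* Otherwise [c] is interior to the subpath of [u], which gives
   [u -> c -> head x N] against the arrowhead at [u]. *)
case: R1 eR dR1 cR1 => [|c' R1] [ec _] dR1 cR1; last first.
  have := into_connectN ancG hu.
  rewrite (connect_trans (connect1 duc)) // connect1 //.
  by apply: dR1; rewrite mem_cat !inE ec eqxx !orbT.
subst y.
(* Likewise [N] is empty: its head would be a parent of [c], but the end [c] of
   the subpath of [u] is not adjacent to this vertex. *)
case: N eL dL1 cL1 yh nyh hu dR1 => [|a N] /= eL dL1 cL1 yh nyh hu dR1;
  last first.
  move: nyh; rewrite adjC dir_adj //.
  by apply: dL1; rewrite mem_cat !inE eqxx !orbT.
have eqK : x :: rcons (u :: rev M ++ [:: b]) c =
    rev (rcons (M ++ [:: u]) x) ++ b :: [:: c].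
  by rewrite !cats1 !rev_rcons /= -!cats1 -catA.
have es' : s = rev L2 ++ (x :: rcons (u :: rev M ++ [:: b]) c) ++ R.
  by rewrite es eL eqK -[_ ++ x :: L2]cat_rcons rev_cat -!catA.
have [ss Us _ _ _] := cs.
have [S0 _] := maxG xc nxc; apply.
apply: (@inducing_path_m_connected _ _ _ (u :: rev M ++ [:: b])).
- apply/and3P; split; last by rewrite last_rcons.
    move: ss; rewrite es' => /(cat_sorted2 (leT := _)) [_ /cat_sorted2[]].
    by [].
  move: Us; rewrite es' cat_uniq => /and3P[_ _].
  by rewrite cat_uniq => /and3P[].
- have cC a b' c' : collider G a b' c' -> collider G c' b' a.
    by rewrite colliderC.
  have : colliders G (rev (rcons M u) ++ b :: [:: c]).
    by move: cR1; rewrite rev_rcons /= rcons_cat.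
  case/(triples_zip _ _ _ cC) => _ tbc mb.
  rewrite eqK; apply/(triples_zip _ _ _ cC); split=> //.
  by case: (M) mb.
have xu : adj G x u.
  by move: ss; rewrite es' => /cat_sorted2[_] /= /andP[].
have bc : adj G b c.
  rewrite es in cs.
  by case/connecting_zip: cs => -[/andP[_ /= /andP[]]].
move=> z; rewrite -cat_cons mem_cat mem_seq1 => zK.
have /orP[zL1|/eqP->] : (z \in M ++ [:: u]) || (z == b).
  move: zK; rewrite in_cons mem_rev mem_cat mem_seq1.
  by case/orP=> [/orP[]|] ->; rewrite ?orbT.
- have zc := dL1 z zL1; split; [|exact: dir_adj|].
    move: zL1; rewrite mem_cat mem_seq1 => /orP[zM|/eqP-> //].
    by rewrite adjC dir_adj // dR1 // mem_cat mem_rev zM.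
  by rewrite /collider (negPf (dir_intoN ancG zc)) andbF.
have bx : dir G b x by apply: dR1; rewrite mem_cat mem_seq1 eqxx orbT.
split=> //; first by rewrite adjC dir_adj.
by rewrite /collider (negPf (dir_intoN ancG bx)).
Qed.

(** By induction on the position of [b], the vertex [u] closest to [b] among
    those that disagree on the subpath of [b] is not discriminated from its
    left, hence it is from its right.  The subpath on that side contains a
    vertex that disagrees, so it extends at least to [b]: the two vertices
    discriminate each other. *)
Lemma lightest_left_agree i j s L b c R :
  lightest G S i j s -> s = rev L ++ b :: c :: R -> discriminated G L b c ->
  ~~ disagree G H s b.
Proof.
move=> smin; have [cs _] := smin; have Us : uniq s by case: cs.
have [n] := ubnP (size L); elim: n L b c R => // n IH L b c R Ln es.
case=> L1 [x [L2 [eL dis]]]; apply/negP => db.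
rewrite eL in es.
have hasL1 := disagree_discriminates cs es dis db.
case/split_find: hasL1 es eL dis => u M N du ndM.
rewrite cat_rcons => es eL dis.
have es' : s = rev (N ++ x :: L2) ++ u :: rev M ++ b :: c :: R.
  by rewrite es -[(M ++ _) ++ _]catA cat_cons rev_cat rev_cons -catA cat_rcons.
have [a [L3 [h [R3 [eL3 eR3 ne]]]]] := disagreeP Us es' du.
rewrite eL3 eR3 in es'; have smin' := smin; rewrite es' in smin'.
have ah : adj G a h.
  have [_ unsh _] := GH; apply/negPn/negP => nah; case/negP: ne; apply/eqP.
  have csu := cs; rewrite es' in csu.
  case/connecting_zip: csu => -[/andP[/andP[ua _] /andP[uh _]] U _ _ _] _.
  apply: unsh => //; last by rewrite adjC.
  apply: contraTneq U => ->.
  by rewrite cat_cons cons_uniq mem_cat !inE eqxx !orbT.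
have [dl|] := shielded_discriminated ancG smin' ah.
  suff szL : size (a :: L3) < n by have /negP[] := IH _ _ _ _ szL es' dl.
  by move: Ln; rewrite eL -eL3 !size_cat /=; clear; lia.
case=> R1 [y [R2 [eR disR]]].
have hasR1 : has (disagree G H s) R1.
  have es'' : rev s = rev (R1 ++ y :: R2) ++ u :: a :: L3.
    by rewrite es' rev_zip eR.
  have := disagree_discriminates (connecting_rev cs) es'' disR.
  by rewrite disagree_rev (eq_has (disagree_rev _ _ _)); apply.
have sR1 : size (rev M) < size R1.
  rewrite ltnNge; apply/negP => leR; move: ndM; rewrite -has_rev.
  have -> : rev M = R1 ++ drop (size R1) (rev M).
    have := congr1 (take (size R1)) (etrans eR3 eR).
    by rewrite takel_cat // take_size_cat // => {1}<-; rewrite cat_take_drop.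
  by rewrite has_cat hasR1.
have [b' [R1' eR1]] : exists b' R1', R1 = rev M ++ b' :: R1'.
  have := congr1 (take (size (rev M))) (etrans eR3 eR).
  rewrite take_size_cat // takel_cat ?(ltnW sR1) // => eM.
  have := cat_take_drop (size (rev M)) R1; rewrite -eM.
  case: (drop _ _) (size_drop (size (rev M)) R1) => [|b' R1'] /= sd <-.
    by move: sR1; rewrite -subn_gt0 -sd.
  by exists b', R1'.
have := etrans eR3 eR; rewrite eR1 -catA => /eqP.
rewrite eqseq_cat // eqxx /= => /eqP[eb eR'].
have ea : a = head x N by case: (N) eL3 => [|? ?] [].
rewrite eR1 -eb ea in disR.
by apply: (no_mutual_discrimination cs _ _ dis eR' disR); [exact: es|exists L2].
Qed.

End LightestPath.

Section Transfer.
Context (G H : mixed_graph V) (S : {set V}).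
Context (ancG : ancestral G) (maxG : maximal G) (GH : agree G H).

Lemma lightest_agree i j s : lightest G S i j s ->
  triples (fun a b c => collider G a b c = collider H a b c) s.
Proof.
move=> smin; apply: agree_triples => b /splitPr sb.
case: sb smin => L R; rewrite -[L]revK; move: (rev L) => {}L smin.
apply/negP => db; have [cs _] := smin.
have Us : uniq (rev L ++ b :: R) by case: cs.
have [a [L' [c [R' [eL eR ne]]]]] := disagreeP Us erefl db; subst L R.
case/connecting_zip: cs => -[/andP[/andP[ba _] /andP[bc _]] U _ _ _] _.
have ac : adj G a c.
  have [_ unsh _] := GH; apply/negPn/negP => nac; case/negP: ne; apply/eqP.
  apply: unsh => //; last by rewrite adjC.
  apply: contraTneq U => ->.
  by rewrite cat_cons cons_uniq mem_cat !inE eqxx !orbT.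
have [dL|dR] := shielded_discriminated ancG smin ac.
  by have /negP[] := lightest_left_agree ancG maxG GH smin erefl dL.
have := lightest_left_agree ancG maxG GH (lightest_rev smin) (rev_zip _ _ _) dR.
by rewrite disagree_rev db.
Qed.

(** The discriminating subpath makes [b] a non-collider between its neighbour
    [a] and [t] in [H] as well, and the edge from [a] has its arrowhead at
    [b]. *)
Lemma discriminated_child a L b t :
  path (adj G) b (a :: L) -> uniq (b :: a :: L) ->
  triples (fun x y z => collider G x y z = collider H x y z) (b :: a :: L) ->
  dir G b t -> into H a b -> discriminated G (a :: L) b t -> dir H b t.
Proof.
move=> aL U tL bt ab [L1 [x [L2 [eL dis]]]].
have ea : a = head x L1 by case: (L1) eL => [|? ?] [].
move: aL U tL; rewrite eL -cat_rcons cat_path -cat_cons cat_uniq.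
case/andP=> aL _ /andP[U _] tL.
have tL1 := triples_infix (prefixW (prefix_prefix _ _)) tL.
have [_ _ _ cL1] := dis.
apply: (agree_parent ancG GH aL U bt dis); last by rewrite -ea.
apply: (agree_discriminates ancG GH) => // u v w uvw.
by rewrite -(tL1 _ _ _ uvw) (cL1 _ _ _ uvw).
Qed.

(** Along a shortest directed path from a collider to [S], each later edge is
    oriented as in [G] because the triple before it is unshielded; for the
    first edge, the path itself provides an unshielded triple or a
    discriminating path. *)
Lemma agree_has_descendant i j a L b c R :
  lightest G S i j (rev (a :: L) ++ b :: c :: R) -> collider G a b c ->
  has_descendant_in G b S -> has_descendant_in H b S.
Proof.
move=> smin col hb.
have [q [[pq lq] qmin]] : exists q : seq V,
    (path (dir G) b q /\ last b q \in S) /\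
    forall q', path (dir G) b q' /\ last b q' \in S -> size q <= size q'.
  apply: ex_minimizer; case: hb => v vS /connectP[q pq eq].
  by exists q; rewrite -eq.
case: q pq lq qmin => [|t q] pq lq qmin; first by exists b.
have bt : dir G b t by case/andP: pq.
have ht : has_descendant_in G t S.
  by exists (last t q) => //; apply/connectP; exists q => //; case/andP: pq.
have [cs _] := smin; case/connecting_zip: cs => -[/andP[aL aR] U _ _ _] _.
have okC x y z : collider G x y z = collider H x y z ->
    collider G z y x = collider H z y x by rewrite !(colliderC _ z).
case/(triples_zip _ _ _ okC): (lightest_agree smin) => tL tR /= tb.
have [aHb cHb] : into H a b /\ into H c b.
  by move: col; rewrite tb => /andP[].
have Hbt : dir H b t.
  have [dL|dR] := child_discriminated ancG smin col bt ht.
    apply: discriminated_child dL => //.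
    by move: U; rewrite cat_uniq => /and3P[? /norP[? _] _]; apply/andP.
  apply: discriminated_child dR => //.
  by move: U; rewrite cat_uniq => /and3P[].
have pH : path (dir H) b (t :: q).
  apply: (agree_directed_path ancG GH (S := S)) => // q' pq' lq'.
  exact: qmin.
by exists (last b (t :: q)) => //; apply/connectP; exists (t :: q).
Qed.

(** The lightest path that connects in [G] also connects in [H], since only a
    collider that loses its descendants in [S] could block it there. *)
Lemma agree_m_connected i j : m_connected G i j S -> m_connected H i j S.
Proof.
case/m_connectedP=> s0 cs0.
have [s smin] : exists s, lightest G S i j s.
  by apply: ex_minimizer; exists s0.
have [[ss Us ts si sj] _] := smin.
apply/m_connectedP; exists s; split=> //.
  by rewrite (eq_sorted (e' := adj G)) // => x y; case: GH.
move=> a b c abc; rewrite /unblocked -(lightest_agree smin abc).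
have := ts _ _ _ abc; rewrite /unblocked; case: ifP => // col ok.
have {}ok : has_descendant_in G b S by case: ok => [bS|//]; exists b.
right; case/infixP: abc => s1 [s2 es].
apply: (@agree_has_descendant i j a (rev s1) b c s2) ok => //.
by rewrite rev_cons revK cat_rcons -es.
Qed.

End Transfer.

(** * Separating sets and edge counts *)

Lemma m_connected_last G i m z j S :
  is_path G i j (m ++ [:: z; j]) -> colliders G (i :: rcons m z) ->
  all (fun b => b \in S) m ->
  (if collider G (last i m) z j then z \in S else z \notin S) ->
  m_connected G i j S.
Proof.
move=> pm cm /allP mS okz; exists (m ++ [:: z; j]) => //.
suff : triples (unblocked G S) (i :: m ++ [:: z; j]) by [].
have -> : i :: m ++ [:: z; j] =
    rev (last i m :: rev (belast i m)) ++ z :: [:: j].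
  by rewrite rev_cons revK -lastI.
apply/triples_zip; first by move=> ? ? ?; exact: unblockedC.
split; last 1 first.
- by rewrite /= /unblocked; case: ifP okz => // _; left.
- have -> : [:: z, last i m & rev (belast i m)] = rev (i :: rcons m z).
    by rewrite -rcons_cons rev_rcons (lastI i m) rev_rcons.
  apply: triples_rev => [? ? ?|a b c abc]; first exact: unblockedC.
  rewrite /unblocked (cm _ _ _ abc); left; apply: mS.
  exact: triples_interior abc.
exact: triples2.
Qed.

(** A separating set of the ends contains all the colliders of the path: the
    first one outside it, being a parent of [j], would give a connection.  So
    the path can only be blocked at [k].  With [m] empty this is the case of an
    unshielded triple. *)
Lemma separated_collider G i m k j S : ancestral G ->
  is_path G i j (m ++ [:: k; j]) -> colliders G (i :: rcons m k) ->
  all (fun b => dir G b j) m -> ~ m_connected G i j S ->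
  collider G (last i m) k j = (k \notin S).
Proof.
move=> ancG pm cm dm nmc.
have [mS|] := boolP (all (fun b => b \in S) m).
  apply/idP/idP => [col|kS].
    apply/negP => kS; apply: nmc; apply: (m_connected_last pm cm mS).
    by rewrite col.
  apply/negPn/negP => ncol; apply: nmc; apply: (m_connected_last pm cm mS).
  by rewrite (negPf ncol).
rewrite -has_predC => /split_find sm; case: sm pm cm dm => z m1 m2 zS m1S.
rewrite cat_rcons => pm cm; rewrite all_cat /= => /and3P[_ zj _].
case: nmc; apply: (@m_connected_last _ _ m1 z).
- case/and3P: pm => pp U _; apply/and3P; split.
  + move: pp; rewrite -catA cat_path /= => /and3P[pm1 lz _].
    by rewrite cat_path pm1 /= lz dir_adj.
  + apply: subseq_uniq U; rewrite /= eqxx -catA; apply: cat_subseq => //=.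
    by rewrite eqxx sub1seq mem_cat !inE eqxx !orbT.
  + by rewrite last_cat.
- apply: triples_infix cm; rewrite rcons_cat rcons_cons -cat_rcons -cat_cons.
  exact: prefixW (prefix_prefix _ _).
- by move: m1S; rewrite -all_predC; apply: sub_all => b; rewrite /= negbK.
by rewrite /collider (negPf (dir_intoN ancG zj)) andbF.
Qed.

Lemma nb_edges_skel G : ancestral G -> nb_edges G = #|skel G|.
Proof.
move=> ancG; rewrite /nb_edges /skel cardsU disjoint_setI0 ?cards0 ?subn0.
  congr (_ + _); rewrite card_in_imset // => -[a b] [c t] /= ab ct e.
  have [ac bc] : a \in [set c; t]%SET /\ b \in [set c; t]%SET.
    by rewrite -e !inE !eqxx orbT.
  have nab := adj_neq (dir_adj ab); move: ac bc nab; rewrite !inE.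
  case/orP=> /eqP ac; case/orP=> /eqP bc; subst; rewrite ?eqxx // => _.
  by have := dir_acyclic ancG (connect1 ab); rewrite /dir ct.
rewrite finset.disjoints_subset; apply/fintype.subsetP => e.
case/imsetP=> -[a b] /= ab ->; rewrite finset.in_setC.
apply/negP => bab; have [_] := ancG; move/(_ a b bab).
by rewrite connect1.
Qed.

End MixedGraphs.

Section Distribution.
Context (R : realType) (dO : measure_display) (Omega : measurableType dO).
Context (P : probability Omega R) (V : finType) (d : V -> measure_display).
Context (T : forall i, measurableType (d i)) (X : forall i, {RV P >-> T i}).
Implicit Types (G : mixed_graph V).

Lemma maximal_imap_indep G (i j : V) : maximal G -> imap X G -> i != j ->
  ~~ adj G i j -> exists S : {set V}, [/\ S \subset ~: [set i; j]%SET,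
    ~ m_connected G i j S & cond_indep X [set i]%SET [set j]%SET S].
Proof.
move=> maxG impG ij nij; have [S SV nmc] := maxG i j ij nij.
exists S; split=> //; apply: impG.
  have [iS jS] : i \notin S /\ j \notin S.
    by split; apply/negP => /(fintype.subsetP SV); rewrite !inE eqxx ?orbT.
  by rewrite /pairwise_disjoint !finset.disjoints1 !inE ij iS jS.
by move=> a b; rewrite !inE => /eqP-> /eqP->.
Qed.

(** A separating set in [G] is an independence of [X], which the faithfulness
    conditions turn into a separation in [G']; in both graphs membership in
    the separating set tells whether the middle vertex is a collider. *)
Lemma imap_agree G G' : dmag G -> imap X G -> ancestral G' ->
  adj G =2 adj G' -> orientation_condition X G' ->
  discriminating_condition X G' -> agree G G'.
Proof.
move=> [ancG maxG] impG ancG' eqadj ori dis; split=> //.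
  move=> a b c ac ab bc nac.
  have [S [SV nmc ind]] := maximal_imap_indep maxG impG ac nac.
  have nmc' : ~ m_connected G' a c S.
    move=> mc; apply: (ori a b c S) ind => //.
      by rewrite -[_ \in _]/(adj G' a b) -eqadj.
    by rewrite -[_ \in _]/(adj G' b c) -eqadj.
  have pathG K : adj K a b -> adj K b c -> is_path K a c ([::] ++ [:: b; c]).
    move=> Kab Kbc; apply/and3P; split=> //=; first by rewrite Kab Kbc.
    by rewrite !inE negb_or (adj_neq Kab) (adj_neq Kbc) ac.
  rewrite -[a]/(last a [::]).
  rewrite (separated_collider (S := S) ancG) //;
    rewrite ?(separated_collider (S := S) ancG') //;
    by [exact: triples2 | apply: pathG; rewrite -?eqadj].
move=> i m k j discG discG'.
have [pG nij _ cG] := discG; have [pG' _ _ cG'] := discG'.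
have ij : i != j.
  case/and3P: pG => _ + _; rewrite cons_uniq mem_cat !inE negb_or.
  by case/andP=> /andP[_ /norP[]].
have [S [SV nmc ind]] := maximal_imap_indep maxG impG ij nij.
have nmc' : ~ m_connected G' i j S by move=> mc; exact: dis discG' SV mc ind.
have discE K : ancestral K -> discriminating K i m k j ->
    ~ m_connected K i j S ->
    collider K (last i m) k j = (k \notin S).
  move=> ancK [pK _ _ cK] nmcK; apply: separated_collider nmcK => //.
    move=> a b c abc; have [_ cb] := cK b (triples_interior abc).
    apply: cb; apply: infix_trans abc _.
    by rewrite -cat_rcons -cat_cons; exact: prefixW (prefix_prefix _ _).
  by apply/allP => b /cK[].
by rewrite !discE.
Qed.

Lemma adjacency_subset G G' : dmag G -> imap X G ->
  adjacency_condition X G' -> skel G' \subset skel G.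
Proof.
move=> [_ maxG] impG adjc.
have sub i j : dir G' i j || bid G' i j -> adj G i j.
  move=> e; apply/negPn/negP => nij.
  have ij : i != j.
    by apply: (@adj_neq _ G'); rewrite adjE; case/orP: e => ->; rewrite ?orbT.
  have [S [SV _ ind]] := maximal_imap_indep maxG impG ij nij.
  exact: adjc e SV ind.
apply/fintype.subsetP => e; rewrite {1}/skel finset.in_setU.
case/orP=> [/imsetP[[i j] ij ->]|eB] /=.
  by apply: sub; rewrite -[dir G' i j]/((i, j) \in dedges G') ij.
have /cards2P[i [j [_ eij]]] : #|e| == 2 by rewrite (bedges_card2 eB).
by rewrite eij; apply: sub; rewrite /bid -eij eB orbT.
Qed.

Lemma minimal_imap_skel Gstar G : dmag Gstar -> imap X Gstar ->
  minimal_imap X G -> adjacency_condition X Gstar -> skel G = skel Gstar.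
Proof.
move=> dS iS [dG iG Gmin] adjc; apply/esym/eqP.
rewrite eqEcard (adjacency_subset dG iG adjc) /=.
have [[aG _] [aS _]] := (dG, dS).
by rewrite -!nb_edges_skel //; exact: Gmin.
Qed.

End Distribution.

Lemma agree_sym (V : finType) (G H : mixed_graph V) : agree G H -> agree H G.
Proof.
case=> eqadj unsh dis; split.
- by move=> a b; rewrite eqadj.
- by move=> a b c ac ab bc nac; rewrite unsh // eqadj.
- by move=> i m k j dH dG; rewrite dis.
Qed.

Theorem theorem1 (R : realType) (dO : measure_display)
    (Omega : measurableType dO) (P : probability Omega R)
    (V : finType) (d : V -> measure_display)
    (T : forall i : V, measurableType (d i))
    (X : forall i : V, {RV P >-> T i})
    (Gstar G : mixed_graph V) :
  dmag Gstar -> imap X Gstar -> minimal_imap X G ->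
  (adjacency_faithful X Gstar -> skel G = skel Gstar) /\
  (restricted_faithful X Gstar -> markov_equivalent G Gstar).
Proof.
move=> dS iS minG.
split=> [[_ adjc]|[_ adjc ori dis]]; first exact: minimal_imap_skel adjc.
have eqskel := minimal_imap_skel dS iS minG adjc.
have [[aS mS] [dG iG _]] := (dS, minG); have [aG mG] := dG.
have GS : agree G Gstar.
  apply: (imap_agree dG iG aS _ ori dis) => a b.
  by rewrite /adj eqskel.
have eqmc i j S : m_connected G i j S <-> m_connected Gstar i j S.
  by split; apply: agree_m_connected => //; exact: agree_sym.
apply/seteqP; split=> -[[A B] C] [/= dABC sep]; split=> //= a b aA bB /eqmc.
  exact: sep.
exact: sep.
Qed.
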